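(* Let $n\ge3$ be odd with prime factorization $n=p_1^{a_1}p_2^{a_2}\cdots p_k^{a_k}$, where $p_1>p_2>\cdots>p_k$, and let $C_n$ be the cycle on $n$ vertices. Let $m=\frac12\left(n-p_1^{a_1}\cdots p_{k-1}^{a_{k-1}}p_k^{a_k-1}\right)$. Then the $h^*$-vector $(h_0^*,\dots,h_{n-1}^* )$ of the Laplacian simplex $T_{C_n}$ satisfies $h_i^*=1$ for $0\le i<m$ and for $n-m<i\le n-1$, and $h_m^*>1$. Further, $h^*_{(n-1)/2}\ge n\cdot|\mathbb{Z}_n^*|+1$, where $\mathbb{Z}_n^*$ is the group of units of $\mathbb{Z}/n\mathbb{Z}$. In particular, if $n$ is prime, then $h_i^*=1$ for all $i\ne\frac{n-1}{2}$ and $h^*_{(n-1)/2}=n^2-n+1$.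
   Context: For a connected graph $G$ on vertex set $[n]$, its Laplacian $L$ has $L_{ii}=\deg(i)$, $L_{ij}=-1$ if $\{i,j\}$ is an edge and $0$ otherwise. Let $A$ be the $n\times(n-1)$ matrix with $a_{ij}=1$ if $i\le j\le n-1$ and $0$ otherwise, and $L_B=LA$. The Laplacian simplex $T_G\subseteq\mathbb{R}^{n-1}$ is the convex hull of the rows of $L_B$. For a $d$-dimensional lattice polytope $P\subseteq\mathbb{R}^m$, the $h^*$-vector $(h_0^*,\dots,h_d^* )$ is defined by $1+\sum_{t\ge1}|tP\cap\mathbb{Z}^m|z^t=\frac{\sum_{i=0}^dh_i^*z^i}{(1-z)^{d+1}}$. *)

(* Defs.v *)
From HB Require Import structures.
From mathcomp Require Export all_boot all_order all_fingroup all_algebra finmap.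
From mathcomp Require Export boolp classical_sets functions cardinality reals.

Set Implicit Arguments.
Unset Strict Implicit.
Unset Printing Implicit Defensive.

Import GRing.Theory.

Local Open Scope classical_set_scope.
Local Open Scope ring_scope.

(** * Lattice polytopes and h*-vectors *)

Definition conv_rows (R : realType) (k m : nat) (V : 'M[R]_(k, m)) :
    set 'rV[R]_m :=
  [set x | exists w : 'rV[R]_k,
     [/\ forall i, 0 <= w 0 i, \sum_i w 0 i = 1 & x = w *m V]].

Definition affine_dim (R : realType) (k m : nat) (V : 'M[R]_(k.+1, m)) : nat :=
  \rank (\matrix_(i < k.+1) (row i V - row ord0 V)).

Definition lattice_polytope (R : realType) (m d : nat) (P : set 'rV[R]_m) :
    Prop :=
  exists (k : nat) (V : 'M[int]_(k.+1, m)),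
    P = conv_rows (map_mx intr V) /\ affine_dim (map_mx (intr : int -> R) V) = d.

Definition dilate (R : realType) (m t : nat) (P : set 'rV[R]_m) :
    set 'rV[R]_m :=
  [set t%:R *: x | x in P].

Definition lattice_points (R : realType) (m : nat) (P : set 'rV[R]_m) :
    set 'rV[int]_m :=
  [set z | P (map_mx intr z)].

(* [fset_set] is junk on infinite sets, but here it is only used for dilates
   of polytopes, which are bounded. *)
Definition ehrhart (R : realType) (m : nat) (P : set 'rV[R]_m) (t : nat) : nat :=
  #|` fset_set (lattice_points (dilate t P))|.

Definition ehrhart_coef (R : realType) (m : nat) (P : set 'rV[R]_m) (t : nat) :
    int :=
  if t is 0%N then 1 else (ehrhart P t)%:Z.

(* The identity of formal power series
     1 + \sum_(t >= 1) |tP \cap Z^m| z^t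
       = (\sum_(i <= d) h_i z^i) / (1 - z)^(d+1)
   with the denominator, which is invertible in Z[[z]], multiplied out, and
   compared coefficient by coefficient. Only h 0, ..., h d are constrained. *)
Definition hstar_vector (R : realType) (m d : nat) (P : set 'rV[R]_m)
    (h : nat -> int) : Prop :=
  lattice_polytope d P /\
  forall j : nat,
    \sum_(i < j.+1) ((1 - 'X : {poly int}) ^+ d.+1)`_i * ehrhart_coef P (j - i)
    = (\poly_(i < d.+1) h i)`_j.

Lemma hstar_vector_uniq (R : realType) (m d : nat) (P : set 'rV[R]_m)
    (h h' : nat -> int) :
  hstar_vector d P h -> hstar_vector d P h' ->
  forall i, (i <= d)%N -> h i = h' i.
Proof.
move=> [_ hP] [_ hP'] i led.
by have := hP i; rewrite hP' !coef_poly ltnS led.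
Qed.

(** * Laplacian simplices *)

(* A simple graph on the vertex set 'I_n is given by its adjacency relation. *)
Definition laplacian (n : nat) (e : rel 'I_n) : 'M[int]_n :=
  \matrix_(i, j) if i == j then #|[pred l | e i l]|%:Z
                 else if e i j then -1 else 0.

(* Indices are shifted from 1-based to 0-based in both rows and columns, which
   leaves the condition i <= j unchanged. *)
Definition sum_mx (n : nat) : 'M[int]_(n, n.-1) :=
  \matrix_(i, j) if (i <= j)%N then 1 else 0.

Definition laplacianB (n : nat) (e : rel 'I_n) : 'M[int]_(n, n.-1) :=
  laplacian e *m sum_mx n.

Definition laplacian_simplex (R : realType) (n : nat) (e : rel 'I_n) :
    set 'rV[R]_n.-1 :=
  conv_rows (map_mx intr (laplacianB e)).

(* [ordS] is the cyclic successor; this is a simple graph for n >= 3. *)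
Definition cycle_graph (n : nat) : rel 'I_n :=
  fun i j => (j == ordS i) || (i == ordS j).

(* Main.v *)
Require Import Defs.
From mathcomp Require Import zify ring.
Set Implicit Arguments.
Unset Strict Implicit.
Unset Printing Implicit Defensive.
Import Order.TTheory GRing.Theory Num.Theory.

(** A point of [R^(n-1)] with barycentric coordinates [w] (of sum [t]) has [j]-th
    coordinate [w_0 - w_(n-1) + w_j - w_(j+1)] with respect to the rows of [L_B].
    It is a lattice point iff [w] is, modulo 1, an arithmetic progression closing
    up around the cycle; for [n] odd this means [w_i = mu_i + ((c + b i) mod n)/n]
    with [b, c] in [Z/n] and [mu] integral.  Hence the fundamental parallelepiped
    has [n^2] lattice points, indexed by [(b, c)], and [h*_i] counts those of
    height [i].  With [g = gcd(b, n)] the height is [c mod g + (n - g)/2]: the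
    pairs with [b = 0] contribute 1 to each [h*_i], and the other ones only to
    the range [(n - g)/2 <= i < (n + g)/2], where [g] is at most the largest
    proper divisor of [n]. *)

(** * Sums of arithmetic progressions modulo [n] *)

Lemma sum_nat_periodic (F : nat -> nat) (q g : nat) :
  (forall i, F (i + q) = F i) ->
  \sum_(i < g * q) F i = g * \sum_(i < q) F i.
Proof.
move=> perF; elim: g => [|g IHg]; first by rewrite big_ord0.
have perFg k i : F (k * q + i) = F i.
  by elim: k => [|k IHk] //; rewrite mulSnr -addnA addnCA addnC perF.
rewrite !mulSnr big_split_ord /= IHg; congr (_ + _).
by apply: eq_bigr => i _; rewrite perFg.
Qed.

(** As [b] is invertible modulo [q], the terms are a permutation of [0, ..., q - 1]. *)
Lemma sum_affine_mod_coprime (q b c : nat) : coprime q b ->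
  2 * \sum_(i < q) (c + b * i) %% q = q * q.-1.
Proof.
case: q => [|q] cop; first by rewrite big_ord0.
pose f (i : 'I_q.+1) : 'I_q.+1 := inord ((c + b * i) %% q.+1).
have fE i : f i = (c + b * i) %% q.+1 :> nat by rewrite inordK // ltn_pmod.
have f_inj : injective f.
  move=> i j /(congr1 (@nat_of_ord _)); rewrite !fE => /eqP.
  rewrite eqn_modDl.
  wlog le_ji : i j / j <= i => [hw|].
    by case: (leqP j i) => [|/ltnW] h e; [|apply/esym]; apply: hw => //; rewrite eq_sym.
  rewrite eqn_mod_dvd ?leq_mul2l ?le_ji ?orbT // -mulnBr Gauss_dvdr //.
  move=> /dvdnP[k ek]; apply/val_inj => /=.
  by case: k ek => [|k] ek; have := ltn_ord i; nia.
under eq_bigr do rewrite -fE.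
rewrite -(reindex_inj f_inj (op := addn) (P := xpredT) (F := fun i => nat_of_ord i)) /=.
have := bin2_sum q.+1; rewrite big_mkord => ->.
have ev : ~~ odd (q.+1 * q) by rewrite oddM /=; case: (odd q).
by rewrite bin2 mul2n -[RHS]odd_double_half (negbTE ev).
Qed.

Definition residue (n b c i : nat) := (c + b * i) %% n.
(* By [sum_residue], the height of the box point with coordinates
   [residue n b c i / n]. *)
Definition height (n b c : nat) := (c %% gcdn b n + (n - gcdn b n)./2)%N.

(** With [n = q * g] and [b = b' * g], each residue is [c %% g] plus [g] times a term of a
    progression modulo [q] whose step [b'] is prime to [q]; that progression runs through [g] full
    periods. *)
Lemma sum_residue (n b c : nat) : 0 < n -> odd n ->
  \sum_(i < n) residue n b c i = n * height n b c.
Proof.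
move=> n_gt0 n_odd; rewrite /height; set g := gcdn b n.
have g_gt0 : 0 < g by rewrite gcdn_gt0 n_gt0 orbT.
have [q nE] : exists q, n = q * g by apply/dvdnP/dvdn_gcdr.
have [b' bE] : exists b', b = b' * g by apply/dvdnP/dvdn_gcdl.
have cop : coprime q b'.
  rewrite coprime_sym /coprime -(eqn_pmul2r g_gt0) mul1n muln_gcdl -bE -nE.
  exact: eqxx.
have rE i : residue n b c i = c %% g + g * ((c %/ g + b' * i) %% q).
  rewrite /residue {1}(divn_eq c g) bE nE.
  have -> : c %/ g * g + c %% g + b' * g * i
          = (c %/ g + b' * i) * g + c %% g by ring.
  set x := c %/ g + b' * i.
  rewrite {1}(divn_eq x q) mulnDl -mulnA -addnA modnMDl modn_small.
    by rewrite addnC mulnC.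
  have q_gt0 : 0 < q by move: n_gt0; rewrite nE muln_gt0 => /andP[].
  by have := ltn_pmod x q_gt0; have := ltn_pmod c g_gt0; nia.
under eq_bigr do rewrite rE.
rewrite big_split /= sum_nat_const card_ord mulnDr -big_distrr /=.
congr (_ + _).
have := @sum_nat_periodic (fun i => (c %/ g + b' * i) %% q) q g.
rewrite mulnC -nE mulnC => ->; last by move=> i; rewrite mulnDr addnA addnC modnMDl.
have := sum_affine_mod_coprime (c %/ g) cop.
set S := \sum_(i < q) _ => SE.
(* Both [n] and [g] are odd, so the halving in [height] is exact. *)
have evn : ~~ odd (n - g).
  move: n_odd; rewrite nE oddM => /andP[oq og].
  by rewrite oddB ?oddM ?oq ?og // leq_pmull //; lia.
have := odd_double_half (n - g); rewrite (negbTE evn) add0n.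
set H := (_)./2; nia.
Qed.

Local Open Scope ring_scope.

(** * Counting pairs [(b, c)] by height *)

Definition cycle_hstar (n i : nat) : nat :=
  \sum_(b < n) \sum_(c < n) (height n b c == i)%N.

Lemma height_lt (n b c : nat) : (0 < n)%N -> (height n b c < n)%N.
Proof.
move=> n_gt0; rewrite /height.
have g_le : (gcdn b n <= n)%N by apply: dvdn_leq => //; exact: dvdn_gcdr.
have g_gt0 : (0 < gcdn b n)%N by rewrite gcdn_gt0 n_gt0 orbT.
by have := ltn_pmod c g_gt0; lia.
Qed.

Lemma height0 (n c : nat) : (c < n)%N -> height n 0 c = c.
Proof. by move=> ltcn; rewrite /height gcd0n subnn addn0 modn_small. Qed.

(** The summand 1 comes from [b = 0], where the height of [(0, c)] is [c]. *)
Lemma cycle_hstarE (N i : nat) : (i <= N)%N ->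
  cycle_hstar N.+1 i
    = (1 + \sum_(1 <= b < N.+1) \sum_(c < N.+1) (height N.+1 b c == i))%N.
Proof.
move=> le_iN; rewrite /cycle_hstar.
rewrite -(big_mkord xpredT (fun b => \sum_(c < N.+1) (height N.+1 b c == i))%N).
rewrite big_ltn //; congr addn.
rewrite (bigD1 (inord i)) //= height0 inordK // eqxx big1 ?addn0 // => c neq.
by rewrite height0 //; case: eqP => // e; case/eqP: neq; apply: val_inj; rewrite /= inordK.
Qed.

(** A prime factor of [q] is one of the [p i], the smallest of which is [p ord_max]. This will bound
    the cofactor of a proper divisor from below. *)
Lemma last_prime_le_divisor (k : nat) (p a : 'I_k.+1 -> nat) (q : nat) :
  (forall i, prime (p i)) ->
  (forall i j : 'I_k.+1, (i < j)%N -> (p j < p i)%N) ->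
  (1 < q)%N -> (q %| \prod_i p i ^ a i)%N -> (p ord_max <= q)%N.
Proof.
move=> p_prime p_decr q_gt1 q_dvd.
have pr_q := pdiv_prime q_gt1.
have : (pdiv q %| \prod_i p i ^ a i)%N := dvdn_trans (pdiv_dvd q) q_dvd.
rewrite Euclid_dvd_prod // big_has => /hasP[i _].
rewrite Euclid_dvdX // => /andP[+ _]; rewrite dvdn_prime2 // => /eqP e.
apply: leq_trans (pdiv_leq (ltnW q_gt1)); rewrite e.
case: (eqVneq i ord_max) => [->//|neq].
apply/ltnW/p_decr; rewrite ltn_neqAle -ltnS /= ltn_ord andbT.
by apply: contraNneq neq => ei; apply/eqP/val_inj.
Qed.

(* [G] plays the role of the largest proper divisor of [n]. *)
Lemma cycle_hstar_eq1 (N G i : nat) :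
  (forall g, (g %| N.+1)%N -> (g < N.+1)%N -> (g <= G)%N) ->
  (i <= N)%N -> (i < (N.+1 - G)./2)%N || (N.+1 - (N.+1 - G)./2 <= i)%N ->
  cycle_hstar N.+1 i = 1.
Proof.
move=> maxG le_iN hi; rewrite cycle_hstarE // big_nat big1 // => b /andP[b_gt0 ltbN].
rewrite big1 // => c _.
have : (gcdn b N.+1 <= G)%N.
  apply: maxG; first exact: dvdn_gcdr.
  by apply: leq_ltn_trans ltbN; apply: dvdn_leq => //; exact: dvdn_gcdl.
have g_gt0 : (0 < gcdn b N.+1)%N by rewrite gcdn_gt0 orbT.
(* The heights lie in a window of length [g = gcdn b N.+1] starting at [(N.+1 - g)./2], which
   [g <= G] places inside the excluded range. *)
by rewrite /height; have := ltn_pmod c g_gt0; case: eqP => //; lia.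
Qed.

(** The pair [(G, 0)] has this height, besides the one pair with [b = 0]. *)
Lemma cycle_hstar_gt1 (N G : nat) : (0 < G)%N -> (G %| N.+1)%N -> (G < N.+1)%N ->
  (1 < cycle_hstar N.+1 (N.+1 - G)./2)%N.
Proof.
move=> G_gt0 G_dvd ltG; rewrite cycle_hstarE; last by lia.
rewrite (bigD1_seq G) ?iota_uniq ?mem_index_iota ?G_gt0 //=.
rewrite (bigD1 ord0) //= /height (gcdn_idPl G_dvd) mod0n add0n eqxx.
by lia.
Qed.

(** For a unit [b] the gcd is 1, so all [N.+1] values of [c] give height [N./2]; [b = 0] adds one
    more pair. *)
Lemma cycle_hstar_mid (N : nat) : (0 < N)%N ->
  (N.+1 * totient N.+1 + 1 <= cycle_hstar N.+1 (N./2))%N.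
Proof.
move=> N_gt0; rewrite cycle_hstarE; last by lia.
rewrite addnC leq_add2l totient_count_coprime big_ltn //.
rewrite {1}/coprime gcdn0 eqSS eqn0Ngt N_gt0 add0n big_distrr /=.
apply: leq_sum => b _; case cop: (coprime N.+1 b); last by rewrite muln0.
move: cop; rewrite coprime_sym => /eqP g1.
rewrite (eq_bigr (fun=> 1%N)) => [|c _]; first by rewrite sum_nat_const card_ord.
by rewrite /height g1 modn1 add0n subn1 /= eqxx.
Qed.

Lemma cycle_hstar_prime (N : nat) : prime N.+1 ->
  cycle_hstar N.+1 (N./2) = (N.+1 ^ 2 - N.+1 + 1)%N.
Proof.
move=> pr; rewrite cycle_hstarE; last by lia.
rewrite (eq_big_nat _ _ (F2 := fun=> N.+1)).
  by rewrite sum_nat_const_nat; nia.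
move=> b /andP[b_gt0 ltb].
have g1 : gcdn b N.+1 = 1%N.
  by apply/eqP; rewrite -/(coprime _ _) coprime_sym prime_coprime // gtnNdvd.
rewrite (eq_bigr (fun=> 1%N)) => [|c _]; first by rewrite sum_nat_const card_ord muln1.
by rewrite /height g1 modn1 add0n subn1 /= eqxx.
Qed.

(** * Generating polynomials of box points *)

Lemma coef_mul_exp1subXn (p : {poly int}) (n B j : nat) : (j <= B)%N ->
  (p * (1 - 'X^(B.+1)) ^+ n)`_j = p`_j.
Proof.
move=> le_jB; elim: n => [|n IHn]; first by rewrite mulr1.
rewrite exprSr mulrA mulrBr mulr1 coefB coefMXn ltnS le_jB subr0.
exact: IHn.
Qed.

(** Triples [((b, c), mu)] of total height [t]. The bound [B] keeps the type finite and loses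
    nothing when [t <= B], since the entries of [mu] sum to at most [t]. *)
Definition box_points (n B t : nat) :
    {set 'I_n * 'I_n * {ffun 'I_n -> 'I_B.+1}} :=
  [set x : 'I_n * 'I_n * {ffun 'I_n -> 'I_B.+1} |
    (height n x.1.1 x.1.2 + \sum_i x.2 i == t)%N].

Definition height_poly (n : nat) : {poly int} :=
  \sum_(b < n) \sum_(c < n) 'X^(height n b c).

Lemma coef_height_poly (n i : nat) : (height_poly n)`_i = (cycle_hstar n i)%:Z.
Proof.
rewrite /height_poly coef_sum /cycle_hstar raddf_sum /=.
apply: eq_bigr => b _; rewrite coef_sum raddf_sum /=.
by apply: eq_bigr => c _; rewrite coefXn eq_sym; case: eqP.
Qed.

(** Heights add, so the generating polynomial is a product; expanding the [n]-th power of the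
    truncated geometric sum enumerates [mu]. *)
Lemma card_box_points (n B t : nat) :
  #|box_points n B t|%:Z = (height_poly n * (\sum_(k < B.+1) 'X^k) ^+ n)`_t.
Proof.
have -> : (\sum_(k < B.+1) 'X^k) ^+ n
        = \sum_(f : {ffun 'I_n -> 'I_B.+1}) 'X^(\sum_i f i)%N :> {poly int}.
  under [RHS]eq_bigr do rewrite expr_sum.
  rewrite -(bigA_distr_bigA (fun (i : 'I_n) (k : 'I_B.+1) => 'X^k : {poly int})).
  by rewrite prodr_const card_ord.
rewrite /height_poly pair_bigA big_distrlr /= pair_bigA coef_sum /=.
rewrite -sum1_card raddf_sum /= big_mkcond /=.
by apply: eq_bigr => x _; rewrite -exprD coefXn inE eq_sym; case: eqP.
Qed.

(** With [B = j], multiplying by [(1 - 'X) ^+ n] collapses the geometric sums to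
    [(1 - 'X^(j.+1)) ^+ n], which is invisible in degree [j]. Power series are thus avoided. *)
Lemma conv_card_box_points (n j : nat) :
  \sum_(i < j.+1) ((1 - 'X : {poly int}) ^+ n)`_i * #|box_points n j (j - i)|%:Z
    = (cycle_hstar n j)%:Z.
Proof.
under eq_bigr do rewrite card_box_points.
rewrite -coefM mulrCA -exprMn.
have -> : (1 - 'X) * \sum_(k < j.+1) 'X^k = 1 - 'X^(j.+1) :> {poly int}.
  by rewrite -[1 - 'X^_]opprB subrX1 -mulNr opprB.
by rewrite coef_mul_exp1subXn // coef_height_poly.
Qed.

(** * The Laplacian of the cycle and the dimension of its simplex *)

(** From three vertices on, [j], [ordS j] and [ord_pred j] are distinct, so the degree is 2 and the
    indicators do not overlap. *)
Lemma laplacian_cycleE (N : nat) (i j : 'I_N.+1) : (2 <= N)%N ->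
  laplacian (@cycle_graph N.+1) i j
    = (i == j)%:R *+ 2 - (i == ordS j)%:R - (i == ord_pred j)%:R.
Proof.
move=> N_ge2; rewrite mxE /cycle_graph.
have valS (l : 'I_N.+1) : ordS l = (if l == N :> nat then 0 else l.+1)%N :> nat.
  rewrite /=; case: eqP => [->|neq]; first exact: modnn.
  by rewrite modn_small //; have := ltn_ord l; lia.
have valP (l : 'I_N.+1) : ord_pred l = (if l == 0 :> nat then N else l.-1)%N :> nat.
  rewrite /=; case: eqP => [->|neq]; first by rewrite modn_small.
  have -> : ((l + N.+1).-1 = l.-1 + N.+1)%N by lia.
  by rewrite modnDr modn_small //; have := ltn_ord l; lia.
have eP (l k : 'I_N.+1) : (k == ordS l) = (l == ord_pred k).
  by rewrite -[l in RHS]ordSK (inj_eq (can_inj (@ord_predK _))) eq_sym.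
have neSP (l : 'I_N.+1) : (ordS l == ord_pred l) = false.
  apply/eqP => /(congr1 (@nat_of_ord _)); rewrite valS valP.
  by do 2 case: eqP; lia.
have neS (l : 'I_N.+1) : (l == ordS l) = false.
  by apply/eqP => /(congr1 (@nat_of_ord _)); rewrite valS; case: eqP; lia.
have neP (l : 'I_N.+1) : (l == ord_pred l) = false by rewrite -eP.
case: (eqVneq i j) => [->|neq].
  rewrite neS neP /= !subr0.
  have -> : #|[pred l | (l == ordS j) || (j == ordS l)]| = #|pred2 (ordS j) (ord_pred j)|.
    by apply: eq_card => l; rewrite !inE [j == _]eP.
  by rewrite card2 neSP.
rewrite mul0rn sub0r eP.
case: (eqVneq i (ord_pred j)) => [->|neq1].
  by rewrite [_ == ordS _]eq_sym neSP oppr0 add0r.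
by rewrite orFb; case: eqP.
Qed.

Lemma mul_laplacian_cycle (F : comNzRingType) (N : nat) (w : 'rV[F]_N.+1)
    (j : 'I_N.+1) : (2 <= N)%N ->
  (w *m map_mx intr (laplacian (@cycle_graph N.+1))) 0 j
    = w 0 j *+ 2 - w 0 (ordS j) - w 0 (ord_pred j).
Proof.
move=> N_ge2; rewrite mxE.
have sumd (k : 'I_N.+1) : \sum_i w 0 i * (i == k)%:R = w 0 k.
  rewrite (bigD1 k) //= eqxx mulr1 big1 ?addr0 // => i /negbTE ->.
  by rewrite mulr0.
rewrite -[in RHS](sumd j) -(sumd (ordS j)) -(sumd (ord_pred j)).
rewrite -sumrMnl -!sumrB; apply: eq_bigr => i _.
rewrite mxE laplacian_cycleE // !rmorphB /= rmorphMn /= !rmorph_nat.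
by rewrite !mulrBr mulrnAr.
Qed.

Lemma mul_laplacianB_cycle (F : comNzRingType) (N : nat) (w : 'rV[F]_N.+1)
    (j : 'I_N) : (2 <= N)%N ->
  (w *m map_mx intr (laplacianB (@cycle_graph N.+1))) 0 j
    = w 0 0 - w 0 ord_max + w 0 (inord j) - w 0 (inord j.+1).
Proof.
move=> N_ge2; rewrite /laplacianB map_mxM mulmxA mxE.
set y := w *m _.
(* Multiplication by [sum_mx] takes prefix sums, in which the second differences [y] telescope. *)
have -> : \sum_i y 0 i * map_mx intr (sum_mx N.+1) i j
        = \sum_(0 <= i < j.+1) y 0 (inord i).
  rewrite big_mkord (big_ord_widen N.+1 (fun i => y 0 (inord i))); last first.
    by have := ltn_ord j; lia.
  rewrite [RHS]big_mkcond /=; apply: eq_bigr => i _.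
  rewrite !mxE inord_val ltnS.
  by case: leqP => _; rewrite ?rmorph1 ?rmorph0 ?mulr1 ?mulr0.
have yE i : (i < N)%N -> y 0 (inord i) =
   w 0 (inord i) *+ 2 - w 0 (inord i.+1)
     - (if i is i'.+1 then w 0 (inord i') else w 0 ord_max).
  move=> lt_iN; rewrite /y mul_laplacian_cycle //; congr (_ - w 0 _ - _).
    by apply: val_inj; rewrite /= !inordK ?modn_small //; lia.
  case: i lt_iN => [|i] lt_iN; congr (w 0 _); apply: val_inj => /=.
    by rewrite inordK //= modn_small.
  rewrite !inordK //; try lia.
  by rewrite addSn /= modnDr modn_small //; lia.
case: j => j /= lt_jN; elim: j lt_jN => [|j IHj] lt_jN.
  rewrite big_nat1 yE //.
  have -> : inord 0 = 0 :> 'I_N.+1 by apply: val_inj; rewrite /= inordK.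
  by rewrite mulr2n; ring.
rewrite big_nat_recr //= IHj ?yE //; last by lia.
by rewrite mulr2n; ring.
Qed.

(** Affine independence of the vertices: [v] is an arithmetic progression of step [d], closing up
    the cycle forces [d *+ N.+1 = 0], and a constant [v] of sum zero vanishes. *)
Lemma laplacianB_cycle_inj (F : numFieldType) (N : nat) (v : 'rV[F]_N.+1) :
  (2 <= N)%N -> v *m map_mx intr (laplacianB (@cycle_graph N.+1)) = 0 ->
  \sum_i v 0 i = 0 -> v = 0.
Proof.
move=> N_ge2 vL0 sv0.
pose d := v 0 0 - v 0 ord_max.
have inord0 : inord 0 = 0 :> 'I_N.+1 by apply: val_inj; rewrite /= inordK.
have inordN : inord N = ord_max :> 'I_N.+1 by apply: val_inj; rewrite /= inordK.
have vE j : (j <= N)%N -> v 0 (inord j) = v 0 0 + d *+ j.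
  elim: j => [|j IHj] ltj; first by rewrite inord0 addr0.
  have := mul_laplacianB_cycle v (Ordinal ltj) N_ge2.
  rewrite vL0 mxE /= IHj; last by lia.
  rewrite -/d mulrS => e; apply/eqP; rewrite -subr_eq0 -oppr_eq0 [X in _ == X]e.
  by apply/eqP; ring.
have d0 : d = 0.
  have := vE N (leqnn _); rewrite inordN => e.
  have : d *+ N.+1 = 0 by rewrite mulrS {1}/d e; ring.
  by move/eqP; rewrite mulrn_eq0 /= => /eqP.
have vc j : v 0 j = v 0 0 by rewrite -(inord_val j) vE -1?ltnS // d0 mul0rn addr0.
have v00 : v 0 0 = 0.
  move: sv0; rewrite (eq_bigr (fun=> v 0 0)) => [|i _]; last exact: vc.
  by rewrite sumr_const card_ord => /eqP; rewrite mulrn_eq0 /= => /eqP.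
by apply/rowP => j; rewrite vc v00 mxE.
Qed.

(** The left kernel of the edge vectors is at most a line: subtracting a multiple of [delta_mx 0 0]
    turns a kernel vector into an affine relation between the vertices, which is trivial. *)
Lemma laplacianB_cycle_affine_dim (R : realType) (N : nat) : (2 <= N)%N ->
  affine_dim (map_mx (intr : int -> R) (laplacianB (@cycle_graph N.+1))) = N.
Proof.
move=> N_ge2; rewrite /affine_dim; set V := map_mx _ _.
set W := \matrix_(i < N.+1) _.
apply/eqP; rewrite eqn_leq rank_leq_col /=.
have : (kermx W <= (delta_mx 0 0 : 'rV[R]_N.+1))%MS.
  apply/row_subP => i; set w := row i _.
  have wW : w *m W = 0 by apply/sub_kermxP; exact: row_sub.
  have wWE : (w - (\sum_i w 0 i) *: delta_mx 0 0) *m V = w *m W.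
    rewrite mulmxBl -scalemxAl -rowE (mulmx_sum_row w W) (mulmx_sum_row w V).
    rewrite scaler_suml -sumrB; apply: eq_bigr => l _.
    by rewrite rowK scalerBr.
  have : w - (\sum_i w 0 i) *: delta_mx 0 0 = 0.
    apply: (laplacianB_cycle_inj N_ge2); first by rewrite -/V wWE.
    rewrite (eq_bigr (fun l => w 0 l - (\sum_i w 0 i) * (l == 0)%:R)).
      rewrite sumrB -mulr_sumr [X in _ * X](_ : _ = 1) ?mulr1 ?subrr //.
      by rewrite (bigD1 0) //= big1 ?addr0 // => l /negbTE ->.
    by move=> l _; rewrite !mxE eqxx.
  move/eqP; rewrite subr_eq0 => /eqP ->.
  exact: scalemx_sub.
move/mxrankS; rewrite mxrank_ker mxrank_delta.
by rewrite leq_subLR addn1 ltnS.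
Qed.

(** * Box points as the lattice points of dilates *)

Section BoxToLattice.
Variables (N B : nat).
Hypotheses (N_ge2 : (2 <= N)%N) (N_even : ~~ odd N).
Local Notation box := ('I_N.+1 * 'I_N.+1 * {ffun 'I_N.+1 -> 'I_B.+1})%type.
Implicit Type x : box.

(* [box_numer x i / N.+1] is the [i]-th barycentric coordinate of the point
   with parameters [x = (b, c, mu)]. *)
Definition box_numer x (i : 'I_N.+1) : nat :=
  x.2 i * N.+1 + residue N.+1 x.1.1 x.1.2 i.

(** The point with these barycentric coordinates, computed in [int]; the division is exact because
    the numerators are congruent to [c + b * i]. *)
Definition box_point x : 'rV[int]_N :=
  \row_j (((box_numer x ord0)%:Z - (box_numer x ord_max)%:Z
     + (box_numer x (inord j))%:Z - (box_numer x (inord j.+1))%:Z)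
     %/ N.+1%:Z)%Z.

Definition box_weight (F : numFieldType) x : 'rV[F]_N.+1 :=
  \row_i ((box_numer x i)%:R / N.+1%:R).

Lemma box_numerE x (i : 'I_N.+1) :
  exists k : int, (box_numer x i)%:Z = x.1.2%:Z + x.1.1%:Z * i%:Z + k * N.+1%:Z.
Proof.
exists ((x.2 i)%:Z - ((x.1.2 + x.1.1 * i) %/ N.+1)%N%:Z).
rewrite /box_numer /residue.
by have := divn_eq (x.1.2 + x.1.1 * i) N.+1; lia.
Qed.

Lemma box_point_weight (F : numFieldType) x :
  map_mx intr (box_point x)
    = box_weight F x *m map_mx intr (laplacianB (@cycle_graph N.+1)).
Proof.
apply/rowP => j; rewrite mul_laplacianB_cycle // !mxE.
have [k0 e0] := box_numerE x ord0.
have [kN eN] := box_numerE x ord_max.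
have [kj ej] := box_numerE x (inord j).
have [kS eS] := box_numerE x (inord j.+1).
set X := (X in (X %/ _)%Z).
(* The progression contributes [c - (c + b * N) + (c + b * j) - (c + b * j.+1)], which is
   [- b * N.+1]. *)
have XE : X = N.+1%:Z * (k0 - kN + kj - kS - x.1.1%:Z).
  rewrite /X e0 eN ej eS !inordK; try by have := ltn_ord j; lia.
  by rewrite /= !intS; ring.
rewrite XE mulKz //.
apply: (@mulfI _ N.+1%:R); first by rewrite pnatr_eq0.
rewrite !mulrDr !mulrN !(mulrC N.+1%:R (_ / _)) !divfK ?pnatr_eq0 //.
rewrite [N.+1%:R]pmulrn -intrM -XE /X !(intrD, mulrNz) -!pmulrn.
by [].
Qed.

(** Quotients by [N.+1] recover [mu]; the residues at 0 and 1 recover [c], then [b]. *)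
Lemma box_numer_inj x x' : box_numer x =1 box_numer x' -> x = x'.
Proof.
move=> e.
have eM (i : 'I_N.+1) : residue N.+1 x.1.1 x.1.2 i = residue N.+1 x'.1.1 x'.1.2 i.
  have := congr1 (modn^~ N.+1) (e i).
  by rewrite /box_numer !modnMDl /residue !modn_mod.
have eD : x.2 = x'.2.
  apply/ffunP => i; apply: val_inj => /=.
  by have := e i; rewrite /box_numer eM => /addIn/eqP; rewrite eqn_pmul2r // => /eqP.
have ec : x.1.2 = x'.1.2.
  apply: val_inj => /=; have := eM 0.
  by rewrite /residue !muln0 !addn0 !modn_small.
have eb : x.1.1 = x'.1.1.
  apply: val_inj => /=; have := eM (inord 1).
  rewrite /residue ec inordK; last by lia.
  by rewrite !muln1 => /eqP; rewrite eqn_modDl !modn_small // => /eqP.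
by move: eD ec eb; case: x x' {e eM} => [[b c] u] [[b' c'] u'] /= -> -> ->.
Qed.

Lemma sum_box_numer x :
  (\sum_i box_numer x i
    = N.+1 * (height N.+1 x.1.1 x.1.2 + \sum_i x.2 i))%N.
Proof.
rewrite big_split /= sum_residue // -big_distrl /=.
by rewrite mulnDr addnC; congr addn; exact: mulnC.
Qed.

(** Weights with equal image and equal sum [t] differ by an affine relation between the vertices,
    hence agree. *)
Lemma box_point_inj t : {in box_points N.+1 B t &, injective box_point}.
Proof.
move=> x x'; rewrite !inE => /eqP hx /eqP hx' e.
apply: box_numer_inj => i.
have : box_weight rat x - box_weight rat x' = 0.
  apply: (laplacianB_cycle_inj N_ge2).
    by rewrite mulmxBl -!box_point_weight e subrr.
  rewrite (eq_bigr (fun i => ((box_numer x i)%:R - (box_numer x' i)%:R) / N.+1%:R)).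
    by rewrite -mulr_suml sumrB -!natr_sum !sum_box_numer hx hx' subrr mul0r.
  by move=> l _; rewrite !mxE mulrBl.
move/rowP/(_ i); rewrite !mxE => /eqP; rewrite subr_eq0.
rewrite (inj_eq (mulIf _)) ?invr_eq0 ?pnatr_eq0 // eqr_nat.
by move/eqP.
Qed.

Lemma box_weight_surj (R : realType) (t : nat) (w : 'rV[R]_N.+1) (z : 'rV[int]_N) :
  (t <= B)%N -> (forall i, 0 <= w 0 i) -> \sum_i w 0 i = t%:R ->
  map_mx intr z = w *m map_mx intr (laplacianB (@cycle_graph N.+1)) ->
  exists2 x, x \in box_points N.+1 B t & w = box_weight R x.
Proof.
move=> le_tB w_ge0 sw zE.
have inord0 : inord 0 = 0 :> 'I_N.+1 by apply: val_inj; rewrite /= inordK.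
have inordN : inord N = ord_max :> 'I_N.+1 by apply: val_inj; rewrite /= inordK.
pose d := w 0 0 - w 0 ord_max.
pose Z (j : nat) : int := \sum_(i < N | (i < j)%N) z 0 i.
have wE j : (j <= N)%N -> w 0 (inord j) = w 0 0 + d *+ j - (Z j)%:~R.
  elim: j => [|j IHj] ltj.
    by rewrite inord0 addr0 /Z big1 ?subr0.
  have := mul_laplacianB_cycle w (Ordinal ltj) N_ge2.
  rewrite -zE mxE /= IHj -/d; last by lia.
  have -> : Z j.+1 = z 0 (Ordinal ltj) + Z j.
    rewrite /Z (bigD1 (Ordinal ltj)) //=; congr (_ + _); apply: eq_bigl => i.
    by rewrite ltnS -val_eqE /= andbC -ltn_neqAle.
  rewrite rmorphD /= mulrS => ->; ring.
(* Going once around the cycle shows that [N.+1 * d] is an integer. *)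
have dE : d *+ N.+1 = (Z N)%:~R.
  by have := wE N (leqnn _); rewrite inordN mulrS {2}/d => ->; ring.
pose n : R := N.+1%:R.
have n_gt0 : 0 < n by rewrite ltr0n.
have nwE (i : 'I_N.+1) : n * w 0 i = n * w 0 0 + (Z N * i%:Z - N.+1%:Z * Z i)%:~R.
  rewrite -{1}(inord_val i) wE -1?ltnS // rmorphB !rmorphM /= -dE -!pmulrn -/n.
  by rewrite -mulr_natl -/n -mulr_natl; ring.
(* Found by solving [\sum_i n * w 0 i = n * t] for [n * w 0 0]; [N] being even, [0 + ... + N] is a
   multiple of [N.+1]. *)
pose C : int := t%:Z - Z N * N./2%:Z + \sum_(i < N.+1) Z i.
have CE : n * w 0 0 = C%:~R.
  have : \sum_i n * w 0 i = n * t%:R by rewrite -mulr_sumr sw.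
  rewrite (eq_bigr _ (fun i _ => nwE i)) big_split /= sumr_const card_ord.
  rewrite -rmorph_sum /= sumrB -!mulr_sumr -mulr_natl -/n.
  have -> : \sum_(i < N.+1) i%:Z = N.+1%:Z * N./2%:Z.
    rewrite -PoszM -(big_morph Posz PoszD (erefl _)).
    congr Posz; have := bin2_sum N.+1; rewrite big_mkord => ->.
    rewrite bin2 /= -{2}(odd_double_half N) (negbTE N_even) add0n -doubleMr.
    by rewrite doubleK.
  move=> e; apply: (@mulfI _ n); first by rewrite gt_eqF.
  move: e; rewrite /C mulrA [Z N * _]mulrC -mulrA -mulrBr rmorphM /= -pmulrn -/n.
  move/eqP; rewrite -subr_eq0 => /eqP e.
  apply/eqP; rewrite -subr_eq0 -e; apply/eqP.
  by rewrite !(intrD, mulrNz, intrM) -!pmulrn; ring.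
pose u (i : 'I_N.+1) : int := C + Z N * i%:Z - N.+1%:Z * Z i.
have uE i : n * w 0 i = (u i)%:~R.
  by rewrite nwE CE -rmorphD /= /u addrA.
pose v i : nat := `|u i|%N.
have vE i : (v i)%:Z = u i.
  rewrite /v gez0_abs // -(ler0z R) -uE mulr_ge0 // ?w_ge0 //.
have nwv i : n * w 0 i = (v i)%:R by rewrite uE -vE -pmulrn.
(* Each weight is at most the total [t <= B], so the quotient fits in ['I_B.+1]. *)
have v_le i : (v i %/ N.+1 < B.+1)%N.
  rewrite ltnS; apply: leq_trans le_tB.
  rewrite -ltnS ltn_divLR // mulSn.
  suff : (v i <= t * N.+1)%N by lia.
  rewrite -(ler_nat R) -nwv natrM mulrC -/n ler_pM2r // -sw (bigD1 i) //=.
  by rewrite lerDl sumr_ge0.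
(* As [u i] is congruent to [C + Z N * i] modulo [N.+1], the step and the start are the residues of
   [Z N] and [C]. *)
pose b : 'I_N.+1 := inord `|(Z N %% N.+1%:Z)%Z|%N.
pose c : 'I_N.+1 := inord `|(C %% N.+1%:Z)%Z|%N.
have modE (y : int) : exists k, y = (inord `|(y %% N.+1%:Z)%Z|%N : 'I_N.+1)%:Z + k * N.+1%:Z.
  exists (y %/ N.+1%:Z)%Z; rewrite inordK; last first.
    have := modz_ge0 y (isT : N.+1%:Z != 0); have := ltz_pmod y (isT : 0 < N.+1%:Z).
    by lia.
  by rewrite gez0_abs ?modz_ge0 // addrC -divz_eq.
have resE (i : 'I_N.+1) : residue N.+1 b c i = (v i %% N.+1)%N.
  have [kb bE] := modE (Z N); have [kc cE] := modE C.
  have vbc : (v i)%:Z = (kc + kb * i%:Z - Z i) * N.+1%:Z + (c + b * i)%N%:Z.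
    by rewrite vE /u {1}bE {1}cE -/b -/c PoszD PoszM; ring.
  apply/eqP; rewrite /residue -eqz_nat -!modz_nat vbc modzMDl.
  exact: eqxx.
pose x : box := (b, c, [ffun i => inord (v i %/ N.+1)]).
have numE i : box_numer x i = v i.
  by rewrite /box_numer /x /= ffunE inordK // resE -divn_eq.
exists x; last first.
  apply/rowP => i; rewrite mxE numE -nwv mulrC mulKf //.
  by rewrite gt_eqF.
rewrite inE; apply/eqP/eqP.
rewrite -(eqn_pmul2l (ltn0Sn N)) -sum_box_numer -(eqr_nat R) natr_sum natrM -/n -sw mulr_sumr.
by apply/eqP/eq_bigr => i _; rewrite numE nwv.
Qed.

Lemma lattice_points_dilate_cycle (R : realType) (t : nat) : (0 < t <= B)%N ->
  lattice_points (dilate t (@laplacian_simplex R N.+1 (@cycle_graph N.+1)))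
    = [set` imfset imfset_key box_point (mem (box_points N.+1 B t))]%classic.
Proof.
move=> /andP[t_gt0 le_tB].
have t_neq0 : t%:R != 0 :> R by rewrite pnatr_eq0 -lt0n.
apply/seteqP; split => [z [y [w [w_ge0 sw ->]] zE]|z] /=.
  have [||||x xP wE] := @box_weight_surj R t (t%:R *: w) z.
  - exact: le_tB.
  - by move=> i; rewrite mxE mulr_ge0.
  - by rewrite (eq_bigr (fun i => t%:R * w 0 i)) => [|i _];
      rewrite ?mxE // -mulr_sumr sw mulr1.
  - by rewrite -scalemxAl zE.
  apply/imfsetP; exists x => //=.
  apply/rowP => j; apply: (@intr_inj R).
  have : map_mx intr z = map_mx intr (box_point x) :> 'rV[R]_N.
    by rewrite box_point_weight -wE -scalemxAl zE.
  by move/rowP/(_ j); rewrite !mxE.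
case/imfsetP => x /= xP ->; exists (t%:R^-1 *: map_mx intr (box_point x)); last first.
  by rewrite scalerA divff // scale1r.
exists (t%:R^-1 *: box_weight R x); split.
- by move=> i; rewrite !mxE mulr_ge0 ?invr_ge0 ?divr_ge0 ?ler0n.
- rewrite (eq_bigr (fun i => t%:R^-1 * ((box_numer x i)%:R * N.+1%:R^-1))).
    rewrite -mulr_sumr -mulr_suml -natr_sum sum_box_numer.
    move: xP; rewrite inE => /eqP ->; rewrite natrM mulrAC divff ?pnatr_eq0 // mul1r.
    by rewrite mulVf.
  by move=> i _; rewrite !mxE.
- by rewrite box_point_weight scalemxAl.
Qed.

Lemma ehrhart_cycle (R : realType) (t : nat) : (0 < t <= B)%N ->
  ehrhart (@laplacian_simplex R N.+1 (@cycle_graph N.+1)) t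
    = #|box_points N.+1 B t|.
Proof.
move=> t_bd; rewrite /ehrhart lattice_points_dilate_cycle // set_fsetK.
rewrite card_in_imfset /=; last exact: box_point_inj.
by rewrite cardE.
Qed.

End BoxToLattice.

(** * The h*-vector of the cycle simplex *)

(** [N] does not divide [N.+1], so [N.-1] bounds the proper divisors, and 0 lies below
    [(N.+1 - N.-1)./2 = 1]. *)
Lemma cycle_hstar0 (N : nat) : (2 <= N)%N -> cycle_hstar N.+1 0 = 1%N.
Proof.
move=> N_ge2; apply: (@cycle_hstar_eq1 N N.-1) => //; last by lia.
move=> g g_dvd; rewrite ltnS leq_eqVlt => /orP[/eqP gN|]; last by lia.
move: g_dvd; rewrite gN -addn1 dvdn_addr // dvdn1.
by lia.
Qed.

Lemma card_box_points0 (N B : nat) : (2 <= N)%N -> #|box_points N.+1 B 0| = 1%N.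
Proof.
move=> N_ge2; apply/eqP; rewrite -eqz_nat card_box_points coef0M.
rewrite coef_height_poly cycle_hstar0 // mul1r -horner_coef0 horner_exp.
rewrite horner_sum big_ord_recl /= hornerE big1 ?addr0 ?expr1n // => i _.
by rewrite hornerXn expr0n.
Qed.

Lemma hstar_vector_cycle (R : realType) (N : nat) : (2 <= N)%N -> ~~ odd N ->
  hstar_vector N (@laplacian_simplex R N.+1 (@cycle_graph N.+1))
    (fun i => (cycle_hstar N.+1 i)%:Z).
Proof.
move=> N_ge2 N_even; split.
  exists N, (laplacianB (@cycle_graph N.+1)); split=> //.
  exact: laplacianB_cycle_affine_dim.
move=> j; rewrite coef_poly.
transitivity (cycle_hstar N.+1 j)%:Z.
  (* The box bound [j] covers all dilates [j - i]; at dilate 0 the conventional value 1 matches the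
     single box point of height 0. *)
  rewrite -conv_card_box_points; apply: eq_bigr => i _; congr (_ * _).
  rewrite /ehrhart_coef; case e: (j - i)%N => [|t]; first by rewrite card_box_points0.
  by rewrite (@ehrhart_cycle N j) //; lia.
case: ltnP => // lt_Nj; rewrite /cycle_hstar big1 // => b _; rewrite big1 // => c _.
by case: eqP => // e; have := @height_lt N.+1 b c isT; lia.
Qed.

Theorem theorem5p10 (R : realType) (n : nat) (n_ge3 : (3 <= n)%N)
    (n_odd : odd n)
    (k : nat) (p a : 'I_k.+1 -> nat)
    (p_prime : forall i, prime (p i))
    (a_gt0 : forall i, (0 < a i)%N)
    (p_decr : forall i j : 'I_k.+1, (i < j)%N -> (p j < p i)%N)
    (n_fact : n = (\prod_i p i ^ a i)%N)
    (m : nat)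
    (m_def : m = ((n - (\prod_(i < k.+1 | (i < k)%N) p i ^ a i)
                        * p ord_max ^ (a ord_max - 1))./2)%N) :
  exists h : nat -> int,
    [/\ hstar_vector n.-1 (@laplacian_simplex R n (@cycle_graph n)) h,
        (forall i : nat, (i < m)%N -> h i = 1)
        /\ (forall i : nat, (n - m < i <= n - 1)%N -> h i = 1),
        1 < h m,
        (n * #|units_Zp n| + 1)%:Z <= h ((n - 1) %/ 2)%N
      & prime n ->
          (forall i : nat, (i <= n - 1)%N -> i <> ((n - 1) %/ 2)%N -> h i = 1)
          /\ h ((n - 1) %/ 2)%N = n%:Z ^+ 2 - n%:Z + 1].
Proof.
move: m_def; set G := (_ * _)%N => m_def.
have nG : n = (G * p ord_max)%N.
  rewrite n_fact (bigD1 ord_max) //= mulnC /G -mulnA -expnSr.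
  rewrite subn1 prednK //; congr muln; apply: eq_bigl => i.
  by rewrite -val_eqE /= ltn_neqAle -ltnS ltn_ord andbT.
have p_gt1 := prime_gt1 (p_prime ord_max).
have G_gt0 : (0 < G)%N by move: n_ge3; rewrite nG; case: (G).
have G_dvd : (G %| n)%N by rewrite nG dvdn_mulr.
have G_lt : (G < n)%N by rewrite nG; nia.
(* The cofactor of a proper divisor is at least the smallest prime [p ord_max], and [G] is [n]
   divided by that prime. *)
have maxG g : (g %| n)%N -> (g < n)%N -> (g <= G)%N.
  move=> /dvdnP[q nq] lt_gn.
  have q_gt1 : (1 < q)%N by case: q nq => [|[|q]] nq //; lia.
  have := last_prime_le_divisor (a := a) p_prime p_decr q_gt1.
  rewrite -n_fact {1}nq dvdn_mulr // => /(_ isT) le_pq; nia.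
case: n n_ge3 n_odd n_fact m_def nG G_dvd G_lt maxG => //
  N N_ge2 N_even _ m_def nG G_dvd G_lt maxG.
have mid : ((N.+1 - 1) %/ 2 = N./2)%N by rewrite subn1 divn2.
exists (fun i => (cycle_hstar N.+1 i)%:Z); rewrite mid; split.
- exact: hstar_vector_cycle.
- by split=> i hi; rewrite (cycle_hstar_eq1 maxG) //; lia.
- by rewrite m_def; have := cycle_hstar_gt1 G_gt0 G_dvd G_lt; lia.
- by rewrite card_units_Zp //; have := @cycle_hstar_mid N; lia.
move=> pr_n; split; last by rewrite cycle_hstar_prime //; nia.
move=> i le_iN neq.
(* A prime has 1 as its only proper divisor, and the bound 1 leaves out the index [N./2] alone. *)
rewrite (@cycle_hstar_eq1 N 1) //; [|by lia|by move: N_even => /=; lia].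
move=> g g_dvd lt_g; move: (primeP pr_n) => [_ /(_ g g_dvd)] /orP[/eqP->//|/eqP e].
by lia.
Qed.
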